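(* Let $X$ be a set of symbols and $P,Q,R,S,T\subseteq\mathbb{Q}[X]$ finite sets of polynomials, and let \[ F=\Big(\bigwedge_{p\in P}0\le p\Big)\land\Big(\bigwedge_{q\in Q}\lnot(0\le q)\Big)\land\Big(\bigwedge_{r\in R}\lnot(0=r)\Big)\land\Big(\bigwedge_{s\in S}\mathit{Int}(s)\Big)\land\Big(\bigwedge_{t\in T}\lnot\mathit{Int}(t)\Big). \] Let $B=S\cup\{1\}$, and let $C$ be the least regular cone that contains $P$ and is closed under cutting planes with respect to $\mathrm{units}(C)+\mathbb{Z}\langle B\rangle$. Then $F$ is satisfiable modulo $\mathbf{LIRR}$ if and only if $C$ is consistent and $\mathfrak{M}(C,\mathrm{units}(C)+\mathbb{Z}\langle B\rangle)\models F$.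
   Context: $\mathbb{Z}\langle B\rangle$ is the set of integer linear combinations of elements of $B$. A cone in $\mathbb{Q}[X]$ contains $0$ and is closed under addition and non-negative rational scaling; $\mathrm{units}(C)=\{p:p\in C,-p\in C\}$; $C$ is regular if $1\in C$ and $\mathrm{units}(C)$ is an ideal; consistent if $C\ne\mathbb{Q}[X]$. $C$ is closed under cutting planes w.r.t. $L$ if for all $a,b\in\mathbb{Z}$, $a>0$, $p\in L$: $ap+b\in C\Rightarrow p+\lfloor b/a\rfloor\in C$. $\sigma^Z_{or}$ is the ordered-ring signature ($+,\cdot,0,1,=,\le$) plus a unary predicate $\mathit{Int}$; rational-coefficient atoms abbreviate atoms obtained by clearing denominators. For a regular cone $C$ and $L=\mathrm{units}(C)+L_0$ with $L_0$ a point lattice, $\mathfrak{M}(C,L)$ is the $\sigma^Z_{or}(X)$-structure with universe and ring operations of $\mathbb{Q}[X]/I$, $I=\mathrm{units}(C)$, $x\mapsto x+I$, $\le$ as $\{(p+I,q+I):q-p\in C\}$, and $\mathit{Int}$ as $\{p+I:p\in L\}$. $\mathbf{LIRR}$ is axiomatized by: the commutative ring axioms; reflexivity, transitivity, antisymmetry of $\le$; $\forall x,y,z\,(x\le y\Rightarrow x+z\le y+z)$; $0\le1\land0\ne1$; for each integer $n\ge1$, $\exists x\,(x+\dots+x=1)$; for each integer $n\ge1$, $\forall x\,(0\le x+\dots+x\Rightarrow0\le x)$ ($n$ summands); $\mathit{Int}(1)$; $\forall x,y\,(\mathit{Int}(x)\land\mathit{Int}(y)\Rightarrow\mathit{Int}(x+y))$;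 $\forall x,y\,(\mathit{Int}(x)\land x+y=0\Rightarrow\mathit{Int}(y))$; for all integers $n>0$, $m$: $\forall x\,(\mathit{Int}(x)\land0\le nx+m\Rightarrow0\le x+\lfloor m/n\rfloor)$.
   Formalization: For a polynomial p with rational coefficients, Int(p) is read as ''the element p itself is in Int'' (some v with dv = dp, d the common denominator, has Int(v)), not as the cleared atom Int(dp), under which the claim fails (S={x/2}, P={x-1}, Q={x-2}). *)

(* Defs.v *)
From HB Require Import structures.
From mathcomp Require Import all_boot all_order all_algebra.
From mathcomp Require Import generic_quotient ring_quotient.
From mathcomp Require Import finmap.
From mathcomp Require Import boolp classical_sets.
From mathcomp Require Import monalg.

Set Implicit Arguments.
Unset Strict Implicit.
Unset Printing Implicit Defensive.

Import Order.TTheory GRing.Theory Num.Theory.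

Local Open Scope classical_set_scope.
Local Open Scope ring_scope.

(* Q[X] for an arbitrary, possibly infinite, set X of symbols *)
Notation Qpoly X := {malg rat[{cmonom X}]}.

Definition indet (X : choiceType) (x : X) : Qpoly X := << ucm x >>.

(* TSym: the elements of X are constant symbols of the signature; TVar: the
   first-order variables *)

Inductive term (X : Type) : Type :=
| TVar of nat
| TSym of X
| TZero
| TOne
| TAdd of term X & term X
| TMul of term X & term X.

Inductive formula (X : Type) : Type :=
| FEq of term X & term X
| FLe of term X & term X
| FInt of term X
| FTrue
| FNot of formula X
| FAnd of formula X & formula X
| FImp of formula X & formula X
| FAll of nat & formula X
| FEx of nat & formula X.

Arguments TVar {X}.
Arguments TZero {X}.
Arguments TOne {X}.
Arguments FTrue {X}.

Record structure (X : Type) : Type := Structure {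
  univ :> Type;
  s_sym : X -> univ;
  s_zero : univ;
  s_one : univ;
  s_add : univ -> univ -> univ;
  s_mul : univ -> univ -> univ;
  s_le : univ -> univ -> Prop;
  s_int : univ -> Prop }.

Fixpoint eval (X : Type) (M : structure X) (e : nat -> M) (t : term X) : M :=
  match t with
  | TVar n => e n
  | TSym x => s_sym M x
  | TZero => s_zero M
  | TOne => s_one M
  | TAdd t1 t2 => s_add (eval e t1) (eval e t2)
  | TMul t1 t2 => s_mul (eval e t1) (eval e t2)
  end.

Definition update (U : Type) (e : nat -> U) (n : nat) (a : U) : nat -> U :=
  fun k => if k == n then a else e k.

Fixpoint sat (X : Type) (M : structure X) (e : nat -> M) (f : formula X)
    : Prop :=
  match f with
  | FEq t1 t2 => eval e t1 = eval e t2
  | FLe t1 t2 => s_le (eval e t1) (eval e t2)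
  | FInt t => s_int (eval e t)
  | FTrue => True
  | FNot f1 => ~ sat e f1
  | FAnd f1 f2 => sat e f1 /\ sat e f2
  | FImp f1 f2 => sat e f1 -> sat e f2
  | FAll n f1 => forall a : M, sat (update e n a) f1
  | FEx n f1 => exists a : M, sat (update e n a) f1
  end.

Definition models (X : Type) (M : structure X) (f : formula X) : Prop :=
  forall e : nat -> M, sat e f.

Definition satisfiable_modulo (X : Type) (T : formula X -> Prop)
    (f : formula X) : Prop :=
  exists M : structure X, (forall g, T g -> models M g) /\ models M f.

Definition conjs (X : Type) (fs : seq (formula X)) : formula X :=
  foldr (@FAnd X) FTrue fs.

Definition tmuln (X : Type) (n : nat) (t : term X) : term X :=
  iterop n (@TAdd X) t TZero.

Definition tnum (X : Type) (n : nat) : term X := tmuln n TOne.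
Arguments tnum {X} n.

Definition texp (X : Type) (t : term X) (n : nat) : term X :=
  iterop n (@TMul X) t TOne.

(* 0 <= t + m; the signature has no subtraction, so a negative m is moved to
   the other side *)
Definition le0_addz (X : Type) (t : term X) (m : int) : formula X :=
  match m with
  | Posz k => FLe TZero (TAdd t (tnum k))
  | Negz k => FLe (tnum k.+1) t
  end.

Declare Scope fo_scope.
Delimit Scope fo_scope with fo.
Bind Scope fo_scope with term formula.

Local Notation "0" := TZero : fo_scope.
Local Notation "1" := TOne : fo_scope.
Local Notation "s + t" := (TAdd s t) : fo_scope.
Local Notation "s * t" := (TMul s t) : fo_scope.
Local Notation "s == t" := (FEq s t) : fo_scope.
Local Notation "s <= t" := (FLe s t) : fo_scope.
Local Notation "~ f" := (FNot f) : fo_scope.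
Local Notation "f /\ g" := (FAnd f g) : fo_scope.
Local Notation "f ==> g" := (FImp f g) : fo_scope.
Local Notation x := (TVar 0%N).
Local Notation y := (TVar 1%N).
Local Notation z := (TVar 2%N).
Local Notation "'Ax' f" := (FAll 0%N f) (at level 200) : fo_scope.
Local Notation "'Axy' f" := (FAll 0%N (FAll 1%N f)) (at level 200) : fo_scope.
Local Notation "'Axyz' f" := (FAll 0%N (FAll 1%N (FAll 2%N f)))
  (at level 200) : fo_scope.

Inductive LIRR (X : Type) : formula X -> Prop :=
| LIRR_addA : LIRR (Axyz (x + (y + z) == (x + y) + z))%fo
| LIRR_addC : LIRR (Axy (x + y == y + x))%fo
| LIRR_add0 : LIRR (Ax (0 + x == x))%fo
| LIRR_addN : LIRR (Ax (FEx 1%N (x + y == 0)))%fo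
| LIRR_mulA : LIRR (Axyz (x * (y * z) == (x * y) * z))%fo
| LIRR_mulC : LIRR (Axy (x * y == y * x))%fo
| LIRR_mul1 : LIRR (Ax (1 * x == x))%fo
| LIRR_mulD : LIRR (Axyz (x * (y + z) == x * y + x * z))%fo
| LIRR_le_refl : LIRR (Ax (x <= x))%fo
| LIRR_le_trans : LIRR (Axyz (((x <= y) /\ (y <= z)) ==> (x <= z)))%fo
| LIRR_le_anti : LIRR (Axy (((x <= y) /\ (y <= x)) ==> (x == y)))%fo
| LIRR_le_add : LIRR (Axyz ((x <= y) ==> (x + z <= y + z)))%fo
| LIRR_le01 : LIRR ((0 <= 1) /\ ~ (0 == 1))%fo
| LIRR_div (n : nat) of (1 <= n)%N : LIRR (FEx 0%N (tmuln n x == 1))%fo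
| LIRR_le_div (n : nat) of (1 <= n)%N :
    LIRR (Ax ((0 <= tmuln n x) ==> (0 <= x)))%fo
| LIRR_int1 : LIRR (FInt 1)%fo
| LIRR_intD : LIRR (Axy ((FInt x /\ FInt y) ==> FInt (x + y)))%fo
| LIRR_intN : LIRR (Axy ((FInt x /\ (x + y == 0)) ==> FInt y))%fo
(* divz is the floor of the quotient when the divisor is positive *)
| LIRR_cut (n : nat) (m : int) of (0 < n)%N :
    LIRR (Ax ((FInt x /\ le0_addz (tmuln n x) m)
              ==> le0_addz x (m %/ n%:Z)%Z))%fo.

(* Polynomials with rational coefficients inside formulas.  For p in Q[X] and
    d = denom p, the polynomial d p has integer coefficients, hence is the
    difference of two polynomials with coefficients in nat, which are
    represented by the terms [pos_term p] and [neg_term p]. *)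

Definition denom (X : choiceType) (p : Qpoly X) : nat :=
  \big[lcmn/1%N]_(m <- msupp p) `|denq p@_m|%N.

Definition zcoef (X : choiceType) (p : Qpoly X) (m : {cmonom X}) : int :=
  numq ((denom p)%:R * p@_m).

Definition pos_part (c : int) : nat := if c is Posz k then k else 0%N.
Definition neg_part (c : int) : nat := if c is Negz k then k.+1 else 0%N.

Definition monom_term (X : choiceType) (m : {cmonom X}) : term X :=
  foldr (@TMul X) TOne [seq texp (TSym i) (m i) | i <- finsupp m].

Definition pos_term (X : choiceType) (p : Qpoly X) : term X :=
  foldr (@TAdd X) TZero
    [seq TMul (tnum (pos_part (zcoef p m))) (monom_term m) | m <- msupp p].

Definition neg_term (X : choiceType) (p : Qpoly X) : term X :=
  foldr (@TAdd X) TZero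
    [seq TMul (tnum (neg_part (zcoef p m))) (monom_term m) | m <- msupp p].

(* 0 <= p, as 0 <= d p *)
Definition at_le0 (X : choiceType) (p : Qpoly X) : formula X :=
  FLe (neg_term p) (pos_term p).

(* 0 = p, as 0 = d p *)
Definition at_eq0 (X : choiceType) (p : Qpoly X) : formula X :=
  FEq (neg_term p) (pos_term p).

(* Int(p): the element v determined by d v = d p is in Int.  The atom
   Int(d p) would not do, as it is weaker than Int(p). *)
Definition at_int (X : choiceType) (p : Qpoly X) : formula X :=
  FEx 0%N (FAnd (FEq (TAdd (tmuln (denom p) (TVar 0%N)) (neg_term p))
                     (pos_term p))
                (FInt (TVar 0%N))).

Definition formulaF (X : choiceType) (P Q R S T : {fset Qpoly X})
    : formula X :=
  FAnd (conjs [seq at_le0 p | p <- P])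
 (FAnd (conjs [seq FNot (at_le0 q) | q <- Q])
 (FAnd (conjs [seq FNot (at_eq0 r) | r <- R])
 (FAnd (conjs [seq at_int s | s <- S])
       (conjs [seq FNot (at_int t) | t <- T])))).

Definition is_cone (X : choiceType) (C : set (Qpoly X)) : Prop :=
  [/\ C 0,
      forall p q, C p -> C q -> C (p + q)
    & forall (a : rat) p, 0 <= a -> C p -> C (a *: p)].

Definition units (X : choiceType) (C : set (Qpoly X)) : set (Qpoly X) :=
  [set p | C p /\ C (- p)].

(* not necessarily proper, unlike the ideals of ring_quotient *)
Definition is_ideal (X : choiceType) (I : set (Qpoly X)) : Prop :=
  [/\ I 0,
      forall p q, I p -> I q -> I (p + q)
    & forall p q, I q -> I (p * q)].

Definition is_regular_cone (X : choiceType) (C : set (Qpoly X)) : Prop :=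
  [/\ is_cone C, C 1 & is_ideal (units C)].

Record regular_cone (X : choiceType) := RegularCone {
  rc_set :> set (Qpoly X);
  rc_regular : is_regular_cone rc_set }.

Definition consistent (X : choiceType) (C : set (Qpoly X)) : Prop :=
  C <> setT.

Definition sumset (X : choiceType) (A B : set (Qpoly X)) : set (Qpoly X) :=
  [set p + q | p in A & q in B].

Definition zspan (X : choiceType) (B : {fset Qpoly X}) : set (Qpoly X) :=
  [set p | exists c : Qpoly X -> int, p = \sum_(b <- B) b *~ c b].

Definition closed_under_cutting_planes (X : choiceType)
    (C L : set (Qpoly X)) : Prop :=
  forall (a b : int) (p : Qpoly X), 0 < a -> L p ->
    C (p *~ a + b%:~R) -> C (p + (b %/ a)%Z%:~R).

Definition cp_cone_over (X : choiceType) (P B : {fset Qpoly X})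
    (C : set (Qpoly X)) : Prop :=
  [/\ is_regular_cone C,
      forall p, p \in P -> C p
    & closed_under_cutting_planes C (sumset (units C) (zspan B))].

Definition least_cp_cone (X : choiceType) (P B : {fset Qpoly X})
    (C : set (Qpoly X)) : Prop :=
  cp_cone_over P B C /\ (forall C', cp_cone_over P B C' -> C `<=` C').

(* the hypothesis [least_cp_cone P B C] is never vacuous *)
Lemma least_cp_cone_exists (X : choiceType) (P B : {fset Qpoly X}) :
  exists C : regular_cone X, least_cp_cone P B C.
Proof.
pose C : set (Qpoly X) := [set p | forall C', cp_cone_over P B C' -> C' p].
have Cle C' : cp_cone_over P B C' -> C `<=` C' by move=> hC' p; apply.
have unitsP p : units C p <-> forall C', cp_cone_over P B C' -> units C' p.
  split=> [[Cp CNp] C' hC'|h]; first by split; apply: Cle.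
  by split=> C' hC'; have [] := h _ hC'.
have regC : is_regular_cone C.
  split=> [|C' [[]]//|].
    split=> [C' [[[]]]//|p q Cp Cq C' hC'|a p a0 Cp C' hC'].
      by have [[[_ D _] _ _] _ _] := hC'; apply: D; apply: Cle.
    by have [[[_ _ Z] _ _] _ _] := hC'; apply: Z => //; apply: Cle.
  split=> [|p q /unitsP hp /unitsP hq|p q /unitsP hq]; apply/unitsP=> C' hC'.
  - by have [[_ _ []]] := hC'.
  - by have [[_ _ [_ D _]] _ _] := hC'; apply: D; [apply: hp|apply: hq].
  - by have [[_ _ [_ _ M]] _ _] := hC'; apply: M; apply: hq.
exists (RegularCone regC); split=> //=; split=> // [p pP C' [_ + _]|].
  exact.
move=> a b _ a0 [p /unitsP hp [q qB <-]] Cab C' hC'.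
have [_ _ cp] := hC'; apply: cp => //; last exact: Cle.
by exists p; [exact: hp|exists q].
Qed.

Definition unitsb (X : choiceType) (C : regular_cone X) (p : Qpoly X) : bool :=
  `[< units C p >].

Lemma unitsb_zmod_closed (X : choiceType) (C : regular_cone X) :
  zmod_closed (unitsb C).
Proof.
have [_ _ [I0 ID IM]] := rc_regular C.
split=> [|p q /asboolP Ip /asboolP Iq]; apply/asboolP => //.
by apply: ID => //; rewrite -mulN1r; apply: IM.
Qed.

HB.instance Definition _ (X : choiceType) (C : regular_cone X) :=
  GRing.isZmodClosed.Build (Qpoly X) (unitsb C) (unitsb_zmod_closed C).

(* The quotient is formed with the library's quotient by an additive subgroup,
   because its quotient by an ideal requires the ideal to be proper; the
   product of two cosets is the coset of the product of representatives. *)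
Definition cone_quot (X : choiceType) (C : regular_cone X) :=
  Quotient.quot (GRing.ZmodClosed.clone _ (unitsb C) _).

Definition pcoset (X : choiceType) (C : regular_cone X) (p : Qpoly X)
    : cone_quot C := \pi_(cone_quot C)%qT p.

Definition structM (X : choiceType) (C : regular_cone X) (L : set (Qpoly X))
    : structure X :=
  {| univ := cone_quot C;
     s_sym := fun i => pcoset C (indet i);
     s_zero := pcoset C 0;
     s_one := pcoset C 1;
     s_add := fun u v => pcoset C (repr u + repr v);
     s_mul := fun u v => pcoset C (repr u * repr v);
     s_le := fun u v =>
       exists p q, [/\ u = pcoset C p, v = pcoset C q & rc_set C (q - p)];
     s_int := fun u => exists2 p, L p & u = pcoset C p |}.

(* Main.v *)
(** Every model [M] of LIRR is a Q-algebra, so the symbols of [X] extend to a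
    ring morphism [phi] from Q[X] to [M].  The set of all [p] with
    [0 <= phi p] is a regular cone whose units are the kernel of [phi], and it
    is closed under cutting planes with respect to the polynomials sent to
    integers.  If [M] satisfies the formula, leastness therefore puts [C] inside
    this cone, so [C] is consistent, and everything that holds in the quotient
    by [units C] because of [C] and [B] also holds in [M]; hence the negated
    atoms transfer from [M] to the quotient, while its positive atoms hold by
    construction.  Conversely, the quotient by a consistent [C] is itself a
    model of LIRR. *)

Require Import Defs.
From HB Require Import structures.
From mathcomp Require Import all_boot all_order all_algebra.
From mathcomp Require Import generic_quotient ring_quotient.
From mathcomp Require Import finmap boolp classical_sets monalg.

Set Implicit Arguments.
Unset Strict Implicit.
Unset Printing Implicit Defensive.

Import Order.TTheory GRing.Theory Num.Theory.

Local Open Scope fset_scope.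
Local Open Scope ring_scope.

(** * Evaluation of polynomials in a ring containing the rationals *)

(** Matches the shape of [monom_term]. The product is moved inside [<< _ >>] by multiplicativity; at
    [j], only the factor [i = j] contributes to the exponent. *)
Lemma malgU_prod_indet (X : choiceType) (m : {cmonom X}) :
  << m >> = \prod_(i <- finsupp m) indet i ^+ m i :> Qpoly X.
Proof.
have monoM (k1 k2 : {cmonom X}) :
    << mmul k1 k2 >> = << k1 >> * << k2 >> :> Qpoly X.
  by rewrite malgM_def fgmulUU mulr1.
have monoX (k : {cmonom X}) n :
    << iter n (mmul k) mone >> = << k >> ^+ n :> Qpoly X.
  by elim: n => [|n IH] /=; rewrite ?expr0 // monoM IH exprS.
have iterE i j n : iter n (mmul (ucm i)) (mone : {cmonom X}) j = (n * (i == j))%N.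
  by elim: n => [|n IH] /=; rewrite ?cm1 // cmM cmU IH mulSn.
rewrite (eq_bigr (fun i => << iter (m i) (mmul (ucm i)) mone >>)); last first.
  by move=> i _; rewrite monoX.
rewrite -(big_morph (fun k : {cmonom X} => << k >> : Qpoly X) monoM (erefl _)).
congr << _ >>; apply/eqP/cmP => j.
rewrite (big_morph (fun k : {cmonom X} => k j) (cmM j) (cm1 j)).
under eq_bigr do rewrite iterE.
case: (boolP (j \in finsupp m)) => hj.
  rewrite (big_fsetD1 j) //= eqxx muln1 big1_seq ?addn0 // => i.
  by rewrite !inE => /= /andP[/negPf-> _]; rewrite muln0.
rewrite big1_seq => [|i /= hi]; first by apply/eqP; rewrite cmE_eq0.
by case: eqP hi => [->|]; rewrite ?(negPf hj) // muln0.
Qed.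

Section MonomialEvaluation.
Variables (X : choiceType) (A : comNzRingType) (v : X -> A).

Definition meval (m : {cmonom X}) : A := \prod_(i <- finsupp m) v i ^+ m i.

(** Lets two monomials be evaluated over the union of their supports; the extra factors are zeroth
    powers. *)
Lemma mevalEw (m : {cmonom X}) (d : {fset X}) : finsupp m `<=` d ->
  meval m = \prod_(i <- d) v i ^+ m i.
Proof.
move=> le; rewrite /meval (big_fset_incl _ le) // => i _.
by rewrite -cmE_neq0 negbK => /eqP->; rewrite expr0.
Qed.

Lemma meval_mmorphism : mmorphism meval.
Proof.
split=> [m1 m2|]; last by rewrite /meval mdom1 big_seq_fset0.
rewrite {1}/meval mdomD (mevalEw (fsubsetUl _ (finsupp m2))).
rewrite (mevalEw (fsubsetUr (finsupp m1) _)) -big_split /=.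
by apply: eq_bigr => i _; rewrite cmM exprD.
Qed.

HB.instance Definition _ :=
  isMultiplicative.Build {cmonom X} A meval meval_mmorphism.

Lemma mevalU x : meval (ucm x) = v x.
Proof. by rewrite /meval mdomU big_seq_fset1 cmUU expr1. Qed.

End MonomialEvaluation.

Lemma mulrn_denq (q : rat) : q *+ `|denq q| = (numq q)%:~R.
Proof.
by rewrite numqE -[in RHS](gez0_abs (ltW (denq_gt0 q))) -pmulrn mulr_natr.
Qed.

(** A fraction goes to its numerator times an inverse of its denominator. Invertibility of positive
    integers in [A] also makes them cancellable, so the value depends only on the fraction. *)
Lemma rat_rmorphism_exists (A : comNzRingType) :
  (forall n, (0 < n)%N -> exists y : A, y *+ n = 1) ->
  exists f : rat -> A, zmod_morphism f /\ monoid_morphism f.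
Proof.
move=> divA.
(* The value 0 chosen at [n = 0] is a dummy; denominators are positive. *)
have /choice[inv invP] n : exists y : A, (0 < n)%N -> y *+ n = 1.
  by case: (ltnP 0 n) => [/divA[y yP]|]; [exists y | exists 0].
pose f (q : rat) : A := (numq q)%:~R * inv `|denq q|%N.
have cancel_n (n : nat) (a b : A) : (0 < n)%N -> a *+ n = b *+ n -> a = b.
  move=> n0 ab; rewrite -[a]mulr1 -[b]mulr1 -(invP n n0).
  by rewrite !mulrnAr -!mulrnAl ab.
have d0 q : (0 < `|denq q|)%N by rewrite absz_gt0 denq_neq0.
have denK q : f q *+ `|denq q| = (numq q)%:~R.
  by rewrite /f -mulrnAr invP // mulr1.
(* a fraction may be evaluated without reducing it first *)
have fP q (n : nat) (k : int) :
    (0 < n)%N -> q *+ n = k%:~R -> f q *+ n = k%:~R.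
  move=> n0 qn; apply: (@cancel_n `|denq q|%N); first exact: d0.
  have : numq q *+ n = k *+ `|denq q|.
    apply/(@intr_inj rat); rewrite !rmorphMn /= -qn.
    by rewrite -mulrnA mulnC mulrnA mulrn_denq.
  move=> /(congr1 (fun z : int => z%:~R : A)); rewrite !rmorphMn /= => <-.
  by rewrite -mulrnA mulnC mulrnA denK.
(* Any [y] solving an equation [y *+ n = k] that [q] solves in the rationals equals [f q]. The
   morphism laws follow by exhibiting such equations. *)
have fPu q (n : nat) (k : int) y :
    (0 < n)%N -> q *+ n = k%:~R -> y *+ n = k%:~R -> f q = y.
  by move=> n0 qn yn; apply: (cancel_n n) => //; rewrite yn; apply: fP.
exists f; split=> [p q|]; last split=> [|p q].
- apply: (fPu _ (`|denq p| * `|denq q|)%N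
            (numq p *+ `|denq q| - numq q *+ `|denq p|)).
  + by rewrite muln_gt0 !d0.
  + rewrite mulrnBl rmorphB !rmorphMn /= mulrnA mulrn_denq; congr (_ - _).
    by rewrite mulnC mulrnA mulrn_denq.
  + rewrite mulrnBl rmorphB !rmorphMn /= mulrnA denK; congr (_ - _).
    by rewrite mulnC mulrnA denK.
- by apply: (fPu _ 1%N 1).
- apply: (fPu _ (`|denq p| * `|denq q|)%N (numq p * numq q)).
  + by rewrite muln_gt0 !d0.
  + by rewrite rmorphM /= -!mulrn_denq !mulrnAr !mulrnAl mulrnA.
  + by rewrite rmorphM /= -!denK !mulrnAr !mulrnAl mulrnA.
Qed.

Lemma Qpoly_rmorphism_exists (X : choiceType) (A : comNzRingType) (v : X -> A) :
  (forall n, (0 < n)%N -> exists y : A, y *+ n = 1) ->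
  exists f : {rmorphism Qpoly X -> A}, forall x, f (indet x) = v x.
Proof.
move=> /rat_rmorphism_exists[f [fB fM]].
pose g : {rmorphism rat -> A} := HB.pack f
  (GRing.isZmodMorphism.Build rat A f fB)
  (GRing.isMonoidMorphism.Build rat A f fM).
exists (mmap g (meval v)) => x.
rewrite -(mevalU v) -[RHS]mul1r; apply: etrans (mmapU (f := g) _ _) _.
by congr (_ * _); exact: fM.1.
Qed.

(** * Clearing denominators *)

Lemma dvdn_denom (X : choiceType) (p : Qpoly X) m :
  m \in msupp p -> (`|denq p@_m| %| denom p)%N.
Proof.
move=> hm; rewrite /denom (big_fsetD1 m) //=; exact: dvdn_lcml.
Qed.

Lemma denom_gt0 (X : choiceType) (p : Qpoly X) : (0 < denom p)%N.
Proof.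
rewrite /denom; elim/big_ind: _ => // [a b a0 b0|m _]; first by rewrite lcmn_gt0 a0.
by rewrite absz_gt0 denq_neq0.
Qed.

(** The common denominator is a multiple of that of each coefficient, so taking [numq] loses
    nothing. *)
Lemma zcoefE (X : choiceType) (p : Qpoly X) m :
  m \in msupp p -> (zcoef p m)%:~R = (denom p)%:R * p@_m.
Proof.
move=> /dvdn_denom/dvdnP[k dE].
suff qE : (denom p)%:R * p@_m = (k%:Z * numq p@_m)%:~R.
  by rewrite /zcoef qE numq_int.
rewrite dE intrM numqE natrM -mulrA; congr (_ * _).
by rewrite mulrC -[in RHS](gez0_abs (ltW (denq_gt0 p@_m))) -pmulrn.
Qed.

(** [pos_poly] and [neg_poly] are the polynomials denoted by [pos_term] and [neg_term]. *)
Definition pos_poly (X : choiceType) (p : Qpoly X) : Qpoly X :=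
  \sum_(m <- msupp p) (pos_part (zcoef p m))%:R * << m >>.

Definition neg_poly (X : choiceType) (p : Qpoly X) : Qpoly X :=
  \sum_(m <- msupp p) (neg_part (zcoef p m))%:R * << m >>.

Lemma pos_neg_polyE (X : choiceType) (p : Qpoly X) :
  pos_poly p - neg_poly p = p *+ denom p.
Proof.
rewrite /pos_poly /neg_poly -sumrB [X in _ = X *+ _](monalgE p) -sumrMnl.
apply: eq_big_seq => m hm; rewrite -mulrBl.
have -> : (pos_part (zcoef p m))%:R - (neg_part (zcoef p m))%:R
          = ((zcoef p m)%:~R : rat)%:MP :> Qpoly X.
  rewrite rmorph_int; case: (zcoef p m) => k /=; first by rewrite subr0.
  by rewrite sub0r NegzE mulrNz.
rewrite malgM_def fgmulUU mul1m mulr1 (zcoefE hm) mulr_natl.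
exact: monalgUMn.
Qed.

Lemma malgC_invnK (X : choiceType) n :
  (0 < n)%N -> (n%:R^-1)%:MP *+ n = 1 :> Qpoly X.
Proof.
move=> n0; apply: etrans (esym (monalgUMn _ n _)) _.
by rewrite -[_ *+ n]mulr_natr mulVf // pnatr_eq0 -lt0n.
Qed.

(** * Valuations of polynomials in a structure *)

(** Isolates what is needed to compute terms of a bare structure inside Q[X]. It covers both the
    morphism into a given model and the coset map onto the quotient. *)
Record valuation (X : choiceType) (M : structure X) (phi : Qpoly X -> M)
    : Prop := Valuation {
  val0 : phi 0 = s_zero M;
  val1 : phi 1 = s_one M;
  valD : forall p q, phi (p + q) = s_add (phi p) (phi q);
  valM : forall p q, phi (p * q) = s_mul (phi p) (phi q);
  valX : forall x, phi (indet x) = s_sym M x;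
  val_le : forall p q,
    s_le (phi p) (phi q) <-> s_le (s_zero M) (phi (q - p)) }.

Definition nonneg (X : choiceType) (M : structure X) (phi : Qpoly X -> M)
    : set (Qpoly X) := [set p | s_le (s_zero M) (phi p)].

Section Evaluation.
Variables (X : choiceType) (M : structure X) (phi : Qpoly X -> M).
Hypothesis phiV : valuation phi.
Implicit Types (e : nat -> M) (t : term X) (p : Qpoly X).

(** [iterop] uses [TZero] only for [n = 0], so that case is separate and the induction starts from
    one copy of [t]. *)
Lemma eval_tmuln e t p n :
  eval e t = phi p -> eval e (tmuln n t) = phi (p *+ n).
Proof.
move=> tp; case: n => [|n]; first by rewrite mulr0n (val0 phiV).
rewrite /tmuln iteropS; elim: n => [|n IH] //=.
by rewrite mulrS (valD phiV) tp IH.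
Qed.

Lemma eval_tnum e n : eval e (tnum n) = phi n%:R.
Proof. by apply: eval_tmuln; rewrite (val1 phiV). Qed.

Lemma eval_texp e t p n :
  eval e t = phi p -> eval e (texp t n) = phi (p ^+ n).
Proof.
move=> tp; case: n => [|n]; first by rewrite expr0 (val1 phiV).
rewrite /texp iteropS; elim: n => [|n IH] //=.
by rewrite exprS (valM phiV) tp IH.
Qed.

Lemma eval_monom_term e m : eval e (monom_term m) = phi << m >>.
Proof.
rewrite malgU_prod_indet /monom_term.
elim: (finsupp m : seq X) => [|i s IH] /=.
  by rewrite big_nil (val1 phiV).
by rewrite big_cons (valM phiV) IH (@eval_texp _ _ (indet i)) // (valX phiV).
Qed.

Lemma eval_linear_comb e (c : {cmonom X} -> nat) s :
  eval e (foldr (@TAdd X) TZero [seq TMul (tnum (c m)) (monom_term m) | m <- s])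
  = phi (\sum_(m <- s) (c m)%:R * << m >>).
Proof.
elim: s => [|m s IH] /=; first by rewrite big_nil (val0 phiV).
by rewrite big_cons (valD phiV) (valM phiV) IH eval_tnum eval_monom_term.
Qed.

Lemma eval_pos_term e p : eval e (pos_term p) = phi (pos_poly p).
Proof. exact: eval_linear_comb. Qed.

Lemma eval_neg_term e p : eval e (neg_term p) = phi (neg_poly p).
Proof. exact: eval_linear_comb. Qed.

(** For negative [m] the constant stands on the left of the inequality, and [val_le] brings it
    back. *)
Lemma sat_le0_addz e t p (m : int) :
  eval e t = phi p -> sat e (le0_addz t m) <-> nonneg phi (p + m%:~R).
Proof.
move=> tp; case: m => k; rewrite [sat _ _]/=.
  by rewrite tp -/(tnum k) eval_tnum -(valD phiV).
have := eval_tnum e k.+1; rewrite /= => ->.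
by rewrite tp (val_le phiV) NegzE mulrNz.
Qed.

End Evaluation.

Lemma sat_conjs (X : Type) (M : structure X) (e : nat -> M) (I : eqType)
    (f : I -> formula X) (s : seq I) :
  sat e (conjs [seq f i | i <- s]) <-> forall i, i \in s -> sat e (f i).
Proof.
elim: s => [|i s IH] /=; first by split.
rewrite IH; split=> [[fi fs] j|fs].
  by rewrite inE => /predU1P[->|/fs].
by split=> [|j js]; apply: fs; rewrite inE ?eqxx ?js ?orbT.
Qed.

(** * Models of LIRR *)

Section LIRRModel.
Variables (X : choiceType) (M : structure X).
Hypothesis M_LIRR : forall g, LIRR g -> models M g.

(** The axioms are sentences, so one arbitrary environment suffices to read them as facts about
    elements of [M]. *)
Let e0 : nat -> M := fun=> s_zero M.

Let addA a b c : s_add a (s_add b c) = s_add (s_add a b) c :> M :=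
  M_LIRR (LIRR_addA _) e0 a b c.
Let addC a b : s_add a b = s_add b a :> M := M_LIRR (LIRR_addC _) e0 a b.
Let add0 a : s_add (s_zero M) a = a := M_LIRR (LIRR_add0 _) e0 a.
Let addN a : exists b : M, s_add a b = s_zero M := M_LIRR (LIRR_addN _) e0 a.
Let mulA a b c : s_mul a (s_mul b c) = s_mul (s_mul a b) c :> M :=
  M_LIRR (LIRR_mulA _) e0 a b c.
Let mulC a b : s_mul a b = s_mul b a :> M := M_LIRR (LIRR_mulC _) e0 a b.
Let mul1 a : s_mul (s_one M) a = a := M_LIRR (LIRR_mul1 _) e0 a.
Let mulD a b c : s_mul a (s_add b c) = s_add (s_mul a b) (s_mul a c) :> M :=
  M_LIRR (LIRR_mulD _) e0 a b c.
Let le_refl (a : M) : s_le a a := M_LIRR (LIRR_le_refl _) e0 a.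
Let le_trans (a b c : M) : s_le a b -> s_le b c -> s_le a c :=
  fun ab bc => M_LIRR (LIRR_le_trans _) e0 a b c (conj ab bc).
Let le_anti (a b : M) : s_le a b -> s_le b a -> a = b :=
  fun ab ba => M_LIRR (LIRR_le_anti _) e0 a b (conj ab ba).
Let le_add (a b c : M) : s_le a b -> s_le (s_add a c) (s_add b c) :=
  M_LIRR (LIRR_le_add _) e0 a b c.
Let le01 : s_le (s_zero M) (s_one M) := (M_LIRR (LIRR_le01 _) e0).1.
Let neq01 : s_zero M <> s_one M := (M_LIRR (LIRR_le01 _) e0).2.
Let intD (a b : M) : s_int a -> s_int b -> s_int (s_add a b) :=
  fun ia ib => M_LIRR (LIRR_intD _) e0 a b (conj ia ib).
Let intN (a b : M) : s_int a -> s_add a b = s_zero M -> s_int b :=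
  fun ia ab => M_LIRR (LIRR_intN _) e0 a b (conj ia ab).

Let mul0 a : s_mul a (s_zero M) = s_zero M.
Proof.
have [b ab] := addN (s_mul a (s_zero M)).
have := mulD a (s_zero M) (s_zero M); rewrite add0 => /(congr1 (fun c : M => s_add c b)).
by rewrite /= -addA ab addC add0.
Qed.

(** The carrier of [M] is packed as a commutative ring, to which the evaluation morphism applies
    since the axioms make every positive integer invertible. *)
Lemma LIRR_valuation_exists : exists phi : Qpoly X -> M, valuation phi.
Proof.
(* The signature has no negation: opposites are chosen, and equality and choice on the carrier are
   classical. *)
have [opp oppP] := choice addN.
have addNr a : s_add (opp a) a = s_zero M by rewrite addC oppP.
have mulDl a b c : s_mul (s_add a b) c = s_add (s_mul a c) (s_mul b c) :> M.
  by rewrite mulC mulD !(mulC c).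
pose E : choiceType := HB.pack (univ M) (gen_eqMixin M) (gen_choiceMixin M).
pose V : zmodType := HB.pack (univ M) E
  (GRing.isZmodule.Build E addA addC add0 addNr).
have one_neq0 : (s_one M : V) != 0 by apply/eqP => /esym/neq01.
pose A : comNzRingType := HB.pack (univ M) V
  (GRing.Zmodule_isComNzRing.Build V mulA mulC mul1 mulDl one_neq0).
have [|f fX] := @Qpoly_rmorphism_exists X A (@s_sym X M).
  move=> n n0; have [y yP] := M_LIRR (LIRR_div _ n0) e0; exists y.
  rewrite -[RHS]yP; case: n {n0 yP} => [|n] //.
  rewrite /tmuln iteropS; elim: n => [|n IH] //.
  by rewrite mulrS IH.
have fD p q : f (p + q) = s_add (f p : M) (f q : M) := rmorphD f p q.
have f0 : f 0 = s_zero M := rmorph0 f.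
exists f; split=> // [|p q|p q]; [exact: (rmorph1 f)|exact: (rmorphM f)|].
split=> [/(@le_add _ _ (f (- p)))|/(@le_add _ _ (f p))].
  by rewrite -!fD subrr f0.
by rewrite -!fD subrK add0.
Qed.

Variable phi : Qpoly X -> M.
Hypothesis phiV : valuation phi.

(** For [a = n / d], the multiple [d (a p)] is a sum of [n] copies of [p], and the axiom cancelling
    positive integers in [0 <= d x] removes [d]. *)
Lemma LIRR_nonneg_cone : is_cone (nonneg phi).
Proof.
have nD p q : nonneg phi p -> nonneg phi q -> nonneg phi (p + q).
  move=> hp /(@le_add _ _ (phi p)); rewrite add0 addC -(valD phiV).
  exact: le_trans.
have nMn p n : nonneg phi p -> nonneg phi (p *+ n).
  move=> hp; elim: n => [|n IH]; last by rewrite mulrS; apply: nD.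
  by rewrite mulr0n /nonneg /= (val0 phiV).
split=> [|//|a p a0 hp]; first by rewrite /nonneg /= (val0 phiV).
have d0 : (0 < `|denq a|)%N by rewrite absz_gt0 denq_neq0.
apply: (M_LIRR (LIRR_le_div _ d0) e0).
rewrite (eval_tmuln phiV (p := a *: p)) //.
have aE : a *+ `|denq a| = `|numq a|%:R.
  by rewrite mulrn_denq -[in LHS](@gez0_abs (numq a)) ?numq_ge0 // -pmulrn.
rewrite scalerMnl aE scaler_nat.
exact: nMn.
Qed.

(** Antisymmetry of the order of [M] turns a unit of the cone into an element of the kernel. *)
Lemma LIRR_units_nonneg p : units (nonneg phi) p <-> phi p = s_zero M.
Proof.
have nN q : phi q = s_zero M -> nonneg phi (- q).
  move=> q0; rewrite -[- q]add0r; apply/(val_le phiV).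
  by rewrite q0 (val0 phiV).
split=> [[p0 Np0]|p0].
  apply: le_anti => //; rewrite -(val0 phiV); apply/(val_le phiV).
  by rewrite sub0r.
by split; [rewrite /nonneg /= p0|apply: nN].
Qed.

Lemma LIRR_nonneg_regular : is_regular_cone (nonneg phi).
Proof.
split; [exact: LIRR_nonneg_cone|by rewrite /nonneg /= (val1 phiV)|].
split=> [|p q /LIRR_units_nonneg p0 /LIRR_units_nonneg q0|p q].
- by apply/LIRR_units_nonneg; rewrite (val0 phiV).
- by apply/LIRR_units_nonneg; rewrite (valD phiV) p0 q0 add0.
- by move=> /LIRR_units_nonneg q0; apply/LIRR_units_nonneg; rewrite (valM phiV) q0.
Qed.

Lemma LIRR_nonneg_consistent : consistent (nonneg phi).
Proof.
move=> nT; have [_ n1 _] := LIRR_nonneg_regular.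
have : units (nonneg phi) 1 by split=> //; rewrite nT.
by move=> /LIRR_units_nonneg; rewrite (val1 phiV) => /esym.
Qed.

Lemma LIRR_int_zspan (B : {fset Qpoly X}) :
  (forall b, b \in B -> s_int (phi b)) ->
  forall p, zspan B p -> s_int (phi p).
Proof.
have int1 : s_int (s_one M) := M_LIRR (LIRR_int1 _) e0.
have vN p : s_add (phi p) (phi (- p)) = s_zero M.
  by rewrite -(valD phiV) subrr (val0 phiV).
have iN p : s_int (phi p) -> s_int (phi (- p)) by move=> /intN; apply.
have iD p q : s_int (phi p) -> s_int (phi q) -> s_int (phi (p + q)).
  by move=> ip iq; rewrite (valD phiV); apply: intD.
(* That 0 is an integer is not an axiom; it is obtained as [1 - 1]. *)
have i0 : s_int (phi 0).
  by rewrite -(subrr 1); apply: iD; [|apply: iN]; rewrite (val1 phiV).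
have iMn p n : s_int (phi p) -> s_int (phi (p *+ n)).
  by move=> ip; elim: n => [|n IH]; rewrite ?mulr0n // mulrS; apply: iD.
move=> iB p [c ->]; rewrite big_seq; elim/big_ind: _ => // b bB.
case: (c b) => k; first by apply: iMn; apply: iB.
by rewrite NegzE mulrNz; apply: iN; apply: iMn; apply: iB.
Qed.

(** [I] is left general in order to serve both for the units of [nonneg phi] and for those of
    [C]. *)
Lemma LIRR_int_sumset (B : {fset Qpoly X}) (I : set (Qpoly X)) :
  (forall b, b \in B -> s_int (phi b)) ->
  (forall p, I p -> phi p = s_zero M) ->
  forall p, sumset I (zspan B) p -> s_int (phi p).
Proof.
move=> iB I0 _ [p /I0 p0 [q qB <-]].
by rewrite (valD phiV) p0 add0; apply: LIRR_int_zspan qB.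
Qed.

Lemma LIRR_nonneg_cut (L : set (Qpoly X)) :
  (forall p, L p -> s_int (phi p)) ->
  closed_under_cutting_planes (nonneg phi) L.
Proof.
move=> iL a b p a0 /iL ip; case: a a0 => // n n0 hab.
pose e := update e0 0%N (phi p).
have ep : eval e (TVar 0%N) = phi p by [].
apply/(sat_le0_addz phiV _ ep); apply: (M_LIRR (LIRR_cut _ b n0) e0).
by split=> //; apply/(sat_le0_addz phiV b (eval_tmuln phiV n ep)).
Qed.

(** The atom says that [denom p] times [p] is in the cone, and scaling by the inverse of [denom p]
    stays in it. *)
Lemma sat_at_le0 (e : nat -> M) p : sat e (at_le0 p) <-> nonneg phi p.
Proof.
rewrite /= (eval_pos_term phiV) (eval_neg_term phiV) (val_le phiV).
rewrite pos_neg_polyE; have [_ _ nZ] := LIRR_nonneg_cone.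
rewrite -[_ *+ denom p]scaler_nat; split; last by apply: nZ; rewrite ler0n.
move=> /(nZ (denom p)%:R^-1); rewrite scalerA mulVf ?scale1r.
  by apply; rewrite invr_ge0 ler0n.
by rewrite pnatr_eq0 -lt0n denom_gt0.
Qed.

(** Needed for the quantified variable of [at_int], whose value may lie outside the image of [phi],
    where [eval_tmuln] does not apply. *)
Lemma eval_tmuln_mul (e : nat -> M) (t : term X) n :
  eval e (tmuln n t) = s_mul (phi n%:R) (eval e t).
Proof.
case: n => [|n]; first by rewrite (val0 phiV) mulC mul0.
rewrite /tmuln iteropS; elim: n => [|n IH] /=; first by rewrite (val1 phiV) mul1.
by rewrite mulrS (valD phiV) (val1 phiV) mulC mulD mulC mul1 (mulC _ (phi _)) IH.
Qed.

Lemma LIRR_mul_natl_inj n (a b : M) : (0 < n)%N ->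
  s_mul (phi n%:R) a = s_mul (phi n%:R) b -> a = b.
Proof.
move=> n0 /(congr1 (s_mul (phi (n%:R^-1)%:MP))); rewrite !mulA -(valM phiV).
by rewrite mulr_natr (malgC_invnK _ n0) (val1 phiV) !mul1.
Qed.

(** The equation inside [at_int] has [phi p] as its only solution, because [denom p] is invertible
    in [M]. The case where [a] is zero gives the equality atoms. *)
Lemma LIRR_mul_denomP (a : M) p :
  s_add (s_mul (phi (denom p)%:R) a) (phi (neg_poly p)) = phi (pos_poly p) <->
  a = phi p.
Proof.
have posE : pos_poly p = (denom p)%:R * p + neg_poly p.
  by rewrite mulr_natl -pos_neg_polyE subrK.
rewrite posE (valD phiV) (valM phiV); split=> [|-> //].
move=> /(congr1 (fun c : M => s_add c (phi (- neg_poly p)))) /=.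
rewrite -!addA -(valD phiV) subrr (val0 phiV) ![s_add _ (s_zero M)]addC !add0.
exact/LIRR_mul_natl_inj/denom_gt0.
Qed.

Lemma sat_at_eq0 (e : nat -> M) p : sat e (at_eq0 p) <-> phi p = s_zero M.
Proof.
rewrite /= (eval_pos_term phiV) (eval_neg_term phiV).
have := LIRR_mul_denomP (s_zero M) p; rewrite mul0 add0 => ->.
by split=> ->.
Qed.

Lemma sat_at_int (e : nat -> M) p : sat e (at_int p) <-> s_int (phi p).
Proof.
rewrite [sat _ _]/=; split=> [[a]|ip].
  rewrite eval_tmuln_mul (eval_pos_term phiV) (eval_neg_term phiV).
  by move=> [/LIRR_mul_denomP <-].
exists (phi p); split=> //.
rewrite eval_tmuln_mul (eval_pos_term phiV) (eval_neg_term phiV).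
exact/LIRR_mul_denomP.
Qed.

(** Serves twice: for the given model, and for the quotient once it is known to satisfy the
    axioms. *)
Lemma sat_formulaF (e : nat -> M) (P Q R S T : {fset Qpoly X}) :
  sat e (formulaF P Q R S T) <->
  [/\ forall p, p \in P -> nonneg phi p,
      forall q, q \in Q -> ~ nonneg phi q,
      forall r, r \in R -> phi r <> s_zero M,
      forall s, s \in S -> s_int (phi s)
    & forall t, t \in T -> ~ s_int (phi t)].
Proof.
have satA f g : sat e (FAnd f g) <-> sat e f /\ sat e g by [].
rewrite /formulaF !satA !sat_conjs.
split=> [[hP [hQ [hR [hS hT]]]]|[hP hQ hR hS hT]].
  split=> x hx; first exact/(sat_at_le0 e)/hP.
  - by move=> /(sat_at_le0 e); apply: hQ.
  - by move=> /(sat_at_eq0 e); apply: hR.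
  - exact/(sat_at_int e)/hS.
  - by move=> /(sat_at_int e); apply: hT.
split=> [x hx|]; first exact/sat_at_le0/hP.
split=> [x hx /sat_at_le0|]; first exact: hQ.
split=> [x hx /sat_at_eq0|]; first exact: hR.
split=> x hx; first exact/sat_at_int/hS.
by move=> /sat_at_int; apply: hT.
Qed.

End LIRRModel.

(** * Structures that are images of Q[X] as models of LIRR *)

Section SurjectiveValuation.
Variables (X : choiceType) (M : structure X) (phi : Qpoly X -> M).
Hypothesis phiV : valuation phi.
Hypothesis phi_surj : forall a, exists p, a = phi p.
Hypothesis nonneg_regular : is_regular_cone (nonneg phi).
Hypothesis nonneg_consistent : consistent (nonneg phi).
Hypothesis units_val0 : forall p, units (nonneg phi) p -> phi p = s_zero M.
Hypothesis int1 : s_int (phi 1).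
Hypothesis intD :
  forall p q, s_int (phi p) -> s_int (phi q) -> s_int (phi (p + q)).
Hypothesis intN : forall p, s_int (phi p) -> s_int (phi (- p)).
Hypothesis int_cut :
  closed_under_cutting_planes (nonneg phi) [set p | s_int (phi p)].

Let le_sub p q : s_le (phi p) (phi q) <-> nonneg phi (q - p).
Proof. exact: (val_le phiV). Qed.

Let sub_units p q : units (nonneg phi) (q - p) -> phi p = phi q.
Proof.
move=> /units_val0 h; rewrite -[q](subrK p) (valD phiV) h -(val0 phiV).
by rewrite -(valD phiV) add0r.
Qed.

(** By surjectivity every axiom becomes a statement about polynomials: ring axioms come from Q[X],
    order axioms from the cone [nonneg phi], with [units_val0] giving antisymmetry. *)
Lemma surjective_valuation_LIRR g : LIRR g -> models M g.
Proof.
have [[n0 nD nZ] n1 [_ _ IM]] := nonneg_regular.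
case=> [|||||||||||||n n_gt0|n n_gt0||||n m n_gt0] e.
- move=> a b c; have [p ->] := phi_surj a; have [q ->] := phi_surj b.
  have [r ->] := phi_surj c.
  by rewrite /= /update /= -!(valD phiV) addrA.
- move=> a b; have [p ->] := phi_surj a; have [q ->] := phi_surj b.
  by rewrite /= /update /= -!(valD phiV) addrC.
- move=> a; have [p ->] := phi_surj a.
  by rewrite /= /update /= -(val0 phiV) -(valD phiV) add0r.
- move=> a; have [p ->] := phi_surj a; exists (phi (- p)).
  by rewrite /= /update /= -(val0 phiV) -(valD phiV) subrr.
- move=> a b c; have [p ->] := phi_surj a; have [q ->] := phi_surj b.
  have [r ->] := phi_surj c.
  by rewrite /= /update /= -!(valM phiV) mulrA.
- move=> a b; have [p ->] := phi_surj a; have [q ->] := phi_surj b.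
  by rewrite /= /update /= -!(valM phiV) mulrC.
- move=> a; have [p ->] := phi_surj a.
  by rewrite /= /update /= -(val1 phiV) -(valM phiV) mul1r.
- move=> a b c; have [p ->] := phi_surj a; have [q ->] := phi_surj b.
  have [r ->] := phi_surj c.
  by rewrite /= /update /= -!(valD phiV, valM phiV) mulrDr.
- move=> a; have [p ->] := phi_surj a.
  by rewrite /= /update /= le_sub subrr.
- move=> a b c; have [p ->] := phi_surj a; have [q ->] := phi_surj b.
  have [r ->] := phi_surj c.
  rewrite /= /update /= !le_sub => -[pq qr].
  by rewrite -(subrK q r) -addrA; apply: nD.
- move=> a b; have [p ->] := phi_surj a; have [q ->] := phi_surj b.
  rewrite /= /update /= !le_sub => -[pq qp].
  by apply: sub_units; split; rewrite ?opprB.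
- move=> a b c; have [p ->] := phi_surj a; have [q ->] := phi_surj b.
  have [r ->] := phi_surj c.
  by rewrite /= /update /= -!(valD phiV) !le_sub [p + r]addrC addrKA.
- rewrite /= -(val0 phiV) -(val1 phiV); split; first by rewrite le_sub subr0.
  (* If 0 and 1 had the same image, 1 would be a unit of the cone, and the ideal of units would be
     all of Q[X]. *)
  move=> e01; apply: nonneg_consistent; apply/seteqP; split=> // p _.
  have [] // : units (nonneg phi) (p * 1).
    apply: IM; split=> //; rewrite -[- _]sub0r; apply/le_sub.
    by rewrite -e01 le_sub subrr.
  by rewrite mulr1.
- exists (phi (n%:R^-1)%:MP); rewrite [sat _ _]/= -(val1 phiV).
  by rewrite (eval_tmuln phiV (p := (n%:R^-1)%:MP)) // malgC_invnK.
- move=> a; have [p ->] := phi_surj a; rewrite [sat _ _]/=.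
  rewrite (eval_tmuln phiV (p := p)) // => /(nZ n%:R^-1).
  rewrite -[p *+ n]scaler_nat scalerA mulVf ?scale1r ?pnatr_eq0 -?lt0n //.
  by apply; rewrite invr_ge0 ler0n.
- by rewrite /= -(val1 phiV).
- move=> a b; have [p ->] := phi_surj a; have [q ->] := phi_surj b.
  by rewrite /= /update /= -(valD phiV) => -[]; apply: intD.
- move=> a b; have [p ->] := phi_surj a; have [q ->] := phi_surj b.
  rewrite /= /update /= -(valD phiV) => -[ip pq].
  rewrite (_ : phi q = phi (- p)); first exact: intN.
  rewrite -[q](addKr p) (valD phiV) pq -(val0 phiV) -(valD phiV).
  by rewrite addr0.
- move=> a; have [p ->] := phi_surj a; set e1 := update _ _ _.
  have e1p : eval e1 (TVar 0%N) = phi p by [].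
  rewrite [sat _ _]/= => -[ip].
  move/(sat_le0_addz phiV m (eval_tmuln phiV n e1p)) => h.
  by apply/(sat_le0_addz phiV _ e1p); apply: (int_cut (a := n)).
Qed.

End SurjectiveValuation.

(** * The quotient structure *)

(** Shows that the product of cosets does not depend on representatives; the factors stand on the
    left as in [is_ideal]. *)
Lemma mulrBM_split (A : comNzRingType) (p q p' q' : A) :
  p * q - p' * q' = - q * (p' - p) + - p' * (q' - q).
Proof.
by rewrite !mulNr !mulrBr !opprB [q * p]mulrC [q * p']mulrC addrA subrK.
Qed.

Lemma zspan_mem (X : choiceType) (B : {fset Qpoly X}) b : b \in B -> zspan B b.
Proof.
move=> bB; exists (fun c => (c == b)%:Z).
rewrite (big_fsetD1 b) //= eqxx mulr1z big1_seq ?addr0 // => c.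
by rewrite !inE => /= /andP[/negPf-> _].
Qed.

Lemma zspanD (X : choiceType) (B : {fset Qpoly X}) p q :
  zspan B p -> zspan B q -> zspan B (p + q).
Proof.
move=> [c ->] [d ->]; exists (fun b => c b + d b).
by rewrite -big_split; apply: eq_bigr => b _; rewrite mulrzDr.
Qed.

Lemma zspanN (X : choiceType) (B : {fset Qpoly X}) p :
  zspan B p -> zspan B (- p).
Proof.
move=> [c ->]; exists (fun b => - c b).
by rewrite -sumrN; apply: eq_bigr => b _; rewrite mulrNz.
Qed.

Section QuotientStructure.
Variables (X : choiceType) (C : regular_cone X).

Lemma pcosetP p q : pcoset C p = pcoset C q <-> units C (p - q).
Proof.
split=> [/eqP|h]; [|apply/eqP].
  by rewrite /pcoset -Quotient.idealrBE => /asboolP.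
by rewrite /pcoset -Quotient.idealrBE; apply/asboolP.
Qed.

Lemma repr_pcoset (u : cone_quot C) : pcoset C (repr u) = u.
Proof. exact: reprK. Qed.

Lemma units_repr p : units C (repr (pcoset C p) - p).
Proof. by apply/pcosetP; rewrite repr_pcoset. Qed.

(** Makes the order on cosets independent of representatives. *)
Lemma rc_unitsD p q : units C (p - q) -> rc_set C q -> rc_set C p.
Proof.
have [[_ CD _] _ _] := rc_regular C.
by move=> [h _] Cq; rewrite -[p](subrK q); apply: CD.
Qed.

Lemma units_sub p q : units C p -> units C q -> units C (p - q).
Proof.
have [_ _ [_ ID IM]] := rc_regular C.
by move=> Ip Iq; rewrite -mulN1r; apply: ID => //; apply: IM.
Qed.

(** The operations of [structM] use canonical representatives, which differ from the given
    polynomials by units; the ideal of units absorbs the differences. *)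
Lemma pcoset_valuation (L : set (Qpoly X)) :
  valuation (pcoset C : Qpoly X -> structM C L).
Proof.
have [_ _ [_ ID IM]] := rc_regular C.
have leE p q : s_le (pcoset C p : structM C L) (pcoset C q) <-> rc_set C (q - p).
  split=> [[p' [q' [/pcosetP hp /pcosetP hq]]]|h]; last by exists p, q.
  apply: rc_unitsD; rewrite (_ : _ - _ = (q - q') - (p - p')).
    exact: units_sub.
  by rewrite !opprB addrACA [RHS]addrACA; congr (_ + _); rewrite addrC.
split=> [||p q|p q|x|p q].
- reflexivity.
- reflexivity.
- change (pcoset C (p + q)
          = pcoset C (repr (pcoset C p) + repr (pcoset C q))).
  apply/pcosetP; set p' := repr _; set q' := repr _.
  have -> : p + q - (p' + q') = -1 * ((p' - p) + (q' - q)).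
    by rewrite mulN1r opprD addrACA opprD !opprB.
  by apply/IM/ID; apply: units_repr.
- change (pcoset C (p * q)
          = pcoset C (repr (pcoset C p) * repr (pcoset C q))).
  apply/pcosetP; set p' := repr _; set q' := repr _.
  rewrite mulrBM_split.
  by apply: ID; apply: IM; apply: units_repr.
- reflexivity.
- change (s_zero (structM C L)) with (pcoset C 0 : structM C L).
  by rewrite !leE subr0.
Qed.

Lemma nonneg_pcoset (L : set (Qpoly X)) :
  nonneg (pcoset C : Qpoly X -> structM C L) = rc_set C.
Proof.
apply/seteqP; split=> p.
  move=> [p' [q' [/pcosetP hp /pcosetP hq]]].
  apply: rc_unitsD; rewrite (_ : _ - _ = (p - q') - (0 - p')).
    exact: units_sub.
  by rewrite sub0r opprK opprB addrA addrAC.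
by move=> Cp; exists 0, p; rewrite subr0.
Qed.

(** The set [sumset (units C) Z] is a union of cosets of [units C], so membership can be tested on
    any representative. *)
Lemma s_int_pcoset (Z : set (Qpoly X)) p :
  s_int (pcoset C p : structM C (sumset (units C) Z)) <->
  sumset (units C) Z p.
Proof.
have [_ _ [_ ID _]] := rc_regular C.
split=> [[_ [i hi [z hz <-]] /pcosetP hp]|hp]; last by exists p.
exists (p - (i + z) + i); first exact: ID.
by exists z => //; rewrite -addrA subrK.
Qed.

(** Closure under cutting planes gives the cut axioms, consistency gives that 0 and 1 differ, and
    [1 \in B] makes 1 an integer. *)
Lemma structM_LIRR (B : {fset Qpoly X}) :
  1 \in B -> consistent C ->
  closed_under_cutting_planes C (sumset (units C) (zspan B)) ->
  forall g, LIRR g -> models (structM C (sumset (units C) (zspan B))) g.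
Proof.
move=> B1 Ccons Ccut; set L := sumset _ _.
have [_ _ [I0 ID IM]] := rc_regular C.
refine (@surjective_valuation_LIRR _ _ _ (pcoset_valuation L) _ _ _ _ _ _ _ _).
- by move=> a; exists (repr a); rewrite repr_pcoset.
- by rewrite nonneg_pcoset; apply: rc_regular.
- by rewrite nonneg_pcoset.
- by move=> p; rewrite nonneg_pcoset => pI; apply/pcosetP; rewrite subr0.
- apply/s_int_pcoset; exists 0 => //; exists 1; last by rewrite add0r.
  exact: zspan_mem.
- move=> p q /s_int_pcoset[i Ii [z Bz <-]] /s_int_pcoset[j Ij [w Bw <-]].
  apply/s_int_pcoset; exists (i + j); first exact: ID.
  by exists (z + w); [apply: zspanD|rewrite addrACA].
- move=> p /s_int_pcoset[i Ii [z Bz <-]].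
  apply/s_int_pcoset; exists (- i); first by rewrite -mulN1r; apply: IM.
  by exists (- z); [apply: zspanN|rewrite opprD].
- by rewrite nonneg_pcoset => a b p a0 /s_int_pcoset; apply: Ccut.
Qed.

End QuotientStructure.

(** * Transfer between arbitrary models and the quotient structure *)

Theorem theorem4p2 (X : choiceType) (P Q R S T : {fset Qpoly X})
    (C : regular_cone X) :
  let F := formulaF P Q R S T in
  let B := 1 |` S in
  least_cp_cone P B C ->
  (satisfiable_modulo (@LIRR X) F <->
   consistent C /\ models (structM C (sumset (units C) (zspan B))) F).
Proof.
move=> F B [[_ PC Ccut] Cmin].
have B1 : 1 \in B by apply: fset1U1.
split=> [[M [M_LIRR M_F]]|[Ccons NF]]; last first.
  by exists (structM C (sumset (units C) (zspan B))); split=> // g;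
    apply: structM_LIRR.
have [phi phiV] := LIRR_valuation_exists M_LIRR.
have /(sat_formulaF M_LIRR phiV)[hP hQ hR hS hT] := M_F (fun=> s_zero M).
have iB b : b \in B -> s_int (phi b).
  move=> /fset1UP[->|/hS//]; rewrite (val1 phiV).
  exact: (M_LIRR _ (LIRR_int1 X) (fun=> s_zero M)).
(* Leastness of [C] applies: [phi] kills the units of [nonneg phi] and sends [B] to integers, so the
   cut axioms of [M] close this cone under cutting planes. *)
have CM : (rc_set C `<=` nonneg phi)%classic.
  apply: Cmin; split=> //; first exact: LIRR_nonneg_regular.
  apply: LIRR_nonneg_cut => // p; apply: (LIRR_int_sumset M_LIRR) => // q.
  by move=> /(LIRR_units_nonneg M_LIRR phiV).
have unitsM p : units C p -> phi p = s_zero M.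
  by move=> [Cp CNp]; apply/(LIRR_units_nonneg M_LIRR phiV); split; apply: CM.
have Ccons : consistent C.
  move=> CT; apply: (LIRR_nonneg_consistent M_LIRR phiV).
  by apply/seteqP; split=> // p _; apply: CM; rewrite CT.
split=> // e; set L := sumset _ _.
have N_LIRR := structM_LIRR B1 Ccons Ccut.
apply/(sat_formulaF N_LIRR (pcoset_valuation C L)).
(* An atom over [Q], [R] or [T] true in the quotient would hold in [M], by [CM], [unitsM] and
   [LIRR_int_sumset] respectively. Each [s] is in [L] as [0 + s]. *)
rewrite nonneg_pcoset; split=> // [q /hQ + /CM //|r /hR r0|s sS|t /hT t0].
- by move=> /pcosetP; rewrite subr0 => /unitsM.
- have [_ _ [I0 _ _]] := rc_regular C.
  apply/s_int_pcoset; exists 0 => //; exists s; last by rewrite add0r.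
  by apply: zspan_mem; apply/fset1UP; right.
- by move/s_int_pcoset/(LIRR_int_sumset M_LIRR phiV iB unitsM).
Qed.
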